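(* If $V,W\subset X$ are nonzero subspaces, with principal angles $\theta_1,\dots,\theta_m$, then $\cos\Theta^\perp_{V,W}=\prod_{i=1}^m\sin\theta_i$.
   Context: $X$ is an $n$-dimensional vector space over $\mathbb{R}$ (real case) or $\mathbb{C}$ (complex case) with an inner product $\langle\cdot,\cdot\rangle$ (Hermitian in the complex case, conjugate-linear in the left entry). Subspaces and dimensions are over the same field. Principal angles: for nonzero subspaces $V,W\subset X$, with $p=\dim V$, $q=\dim W$, $m=\min\{p,q\}$, there are orthonormal bases $(e_1,\dots,e_p)$ of $V$ and $(f_1,\dots,f_q)$ of $W$ and uniquely determined numbers $0\le\theta_1\le\dots\le\theta_m\le\frac{\pi}{2}$ (the principal angles) such that $\langle e_i,f_j\rangle=\delta_{ij}\cos\theta_i$ (equal to $0$ whenever $i\neq j$). Grassmann angle: for nonzero subspaces $V,W\subset X$ with principal angles $\theta_1,\dots,\theta_m$, the Grassmann angle $\Theta_{V,W}\in[0,\frac{\pi}{2}]$ of $V$ with $W$ is $\Theta_{V,W}=\arccos(\cos\theta_1\cdots\cos\theta_m)$ if $\dim V\le\dim W$, and $\Theta_{V,W}=\frac{\pi}{2}$ if $\dim V>\dim W$. Also $\Theta_{\{0\},\{0\}}=\Theta_{\{0\},V}=0$ and $\Theta_{V,\{0\}}=\frac{\pi}{2}$ for $V\ne\{0\}$. The complementary Grassmann angle of $V,W$ is $\Theta^\perp_{V,W}=\Theta_{V,W^\perp}$, where $W^\perp$ is the orthogonal complement of $W$ in $X$. *)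

(* Defs.v *)
From mathcomp Require Import all_boot all_order all_algebra.
From mathcomp Require Import all_classical all_reals all_analysis.
From mathcomp Require Export complex.

Set Implicit Arguments.
Unset Strict Implicit.
Unset Printing Implicit Defensive.

Import Order.TTheory GRing.Theory Num.Theory.

Local Open Scope ring_scope.

(* The scalar field K, its conjugation [conj] and the embedding [iota : R -> K]
   of the real numbers are parameters, so that the definitions cover both the
   real case (K = R, with identities) and the complex case (K = R[i]).

   A library form {dot X for conj} is linear in its left argument and
   conjugate-linear in its right one, so the inner product <u, v> that is
   conjugate-linear in the left entry is [form v u]. *)

Definition inner (K : numFieldType) (conj : {rmorphism K -> K})
    (X : vectType K) (form : {dot X for conj}) (u v : X) : K := form v u.

(* Indices start from 0.  For distinct (natural number) indices i and j the
   vectors e`_i and f`_j are orthogonal; if i = j then i < minn p q, so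
   theta`_i is a genuine entry of theta. *)
Definition is_principal_angles (R : realType) (K : numFieldType)
    (conj : {rmorphism K -> K}) (iota : R -> K)
    (X : vectType K) (form : {dot X for conj}) (V W : {vspace X})
    (theta : (minn (\dim V) (\dim W)).-tuple R) : Prop :=
  [/\ sorted <=%R theta,
      forall i, 0 <= tnth theta i <= pi / 2
    & exists (e : (\dim V).-tuple X) (f : (\dim W).-tuple X),
      [/\ basis_of V e, orthonormal form e,
          basis_of W f, orthonormal form f
        & forall (i : 'I_(\dim V)) (j : 'I_(\dim W)),
            inner form (tnth e i) (tnth f j)
            = if i == j :> nat then iota (cos theta`_i) else 0]].

(* Principal angles exist and are unique when V and W are nonzero, so xget
   selects them; the zero tuple is only a formal default. *)
Definition principal_angles (R : realType) (K : numFieldType)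
    (conj : {rmorphism K -> K}) (iota : R -> K)
    (X : vectType K) (form : {dot X for conj}) (V W : {vspace X}) :
    (minn (\dim V) (\dim W)).-tuple R :=
  xget [tuple of nseq _ 0] (@is_principal_angles R K conj iota X form V W).

Definition grassmann_angle (R : realType) (K : numFieldType)
    (conj : {rmorphism K -> K}) (iota : R -> K)
    (X : vectType K) (form : {dot X for conj}) (V W : {vspace X}) : R :=
  if V == 0%VS then 0
  else if W == 0%VS then pi / 2
  else if (\dim V <= \dim W)%N then
    acos (\prod_(t <- principal_angles iota form V W) cos t)
  else pi / 2.

Definition complementary_grassmann_angle (R : realType) (K : numFieldType)
    (conj : {rmorphism K -> K}) (iota : R -> K)
    (X : vectType K) (form : {dot X for conj}) (V W : {vspace X}) : R :=
  grassmann_angle iota form V (orthov form W).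

(* Main.v *)
Require Import Defs.
From mathcomp Require Import all_boot all_order all_algebra.
From mathcomp Require Import all_classical all_reals all_analysis.
From mathcomp Require Import complex.

Set Implicit Arguments.
Unset Strict Implicit.
Unset Printing Implicit Defensive.

Import Order.TTheory GRing.Theory Num.Theory.

Local Open Scope ring_scope.

(** The squared cosine of the Grassmann angle of V with a subspace U is a
determinant.  For orthonormal bases e of V and g of U let M be the matrix of
the products of the e_i with the g_j.  Then M M^* is the Gram matrix of the
orthogonal projections of the e_i on U; another orthonormal basis of V
conjugates it by a unitary matrix, so that its determinant depends on V and U
only ([dot_gram_invariant]).

Take U to be the orthogonal complement of W.  With principal bases of V and U
the matrix is diagonal, and its determinant is the square of the product of
the cosines of the principal angles of V and U
([det_dot_gram_principal]).  With the basis of V that is principal for W, the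
projections on U and on W add up to the identity, so that the Gram matrix is
the identity minus the diagonal matrix of the cos^2 theta_i, that is the
diagonal matrix of the sin^2 theta_i, where theta_i counts as pi/2 once W has
no more basis vectors ([det_dot_gram_orthov]).  Comparing the two
determinants gives the theorem when dim V <= dim U; when dim V > dim U, the
matrix M M^* is singular since its rank is at most dim U, so both sides of the
theorem vanish.

The angle of V with U is that of a chosen tuple of principal angles, which is
meaningful only if such a tuple exists.  It is obtained from the one of V and
W ([principal_angles_orthov]): the components of the e_i in U are already
orthogonal, of norms sin theta_i, so they become a principal basis of U once
they are normalized and completed, and the angles of V with U are the
pi/2 - theta_i in the reverse order.

The real and the complex case are treated together, over a field K with a
conjugation that fixes the image of an embedding of the reals which covers
the nonnegative elements of K. *)

(** * Orthonormal families and projections *)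

Section OrthonormalFamilies.
Variables (K : numFieldType) (conj : {rmorphism K -> K}).
Variables (X : vectType K) (form : {dot X for conj}).
Implicit Types (u v w : X) (s : seq X) (U V W : {vspace X}).

Lemma dotC u v : form u v = conj (form v u).
Proof. by rewrite hermC /= expr0 mul1r. Qed.

Lemma dot0_eq0 u : form u u = 0 -> u = 0.
Proof.
move=> fu0; apply/eqP/contraT => u_neq0.
by have := @neq0_dnorm_gt0 _ _ _ form u u_neq0; rewrite fu0 ltxx.
Qed.

Lemma orthonormal_nthP s :
  reflect (forall i j, (i < size s)%N -> (j < size s)%N ->
             form s`_i s`_j = (i == j)%:R)
          (orthonormal form s).
Proof.
have pairE t : pair_ortho_rec form t = pairwise (fun u v => form u v == 0) t.
  by elim: t => //= v t ->; rewrite /ortho_rec /= andbT.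
rewrite /orthonormal pairE.
apply: (iffP andP) => [[/allP s1 /(pairwiseP 0) s0] i j ilt jlt|H].
  have [ij|ji|<-] := ltngtP i j.
  - by apply/eqP; apply: s0.
  - by rewrite dotC; apply/eqP; rewrite fmorph_eq0; apply: s0.
  - by apply/eqP; apply: s1; apply: mem_nth.
split.
  by apply/allP => v /(nthP 0)[i ilt <-] /=; rewrite H ?eqxx.
by apply/(pairwiseP 0) => i j ilt jlt /ltn_eqF ij; rewrite H ?ij.
Qed.

Lemma orthonormal_tnth n (s : n.-tuple X) i j : orthonormal form s ->
  form (tnth s i) (tnth s j) = (i == j)%:R.
Proof.
by move/orthonormal_nthP=> H; rewrite !(tnth_nth 0) H ?size_tuple.
Qed.

Lemma orthonormal_tnthI n (s : n.-tuple X) :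
  (forall i j, form (tnth s i) (tnth s j) = (i == j)%:R) -> orthonormal form s.
Proof.
move=> H; apply/orthonormal_nthP; rewrite size_tuple => i j ip jp.
by have := H (Ordinal ip) (Ordinal jp); rewrite !(tnth_nth 0).
Qed.

Lemma orthonormal_rcons s v :
  orthonormal form (rcons s v) =
  [&& orthonormal form s, form v v == 1 & all (fun u => form u v == 0) s].
Proof.
rewrite /orthonormal all_rcons /= -!andbA andbCA; congr andb.
rewrite [RHS]andbCA; congr andb.
elim: s => //= u s ->; rewrite /ortho_rec /= !andbT all_rcons /=.
by case: (form u v == 0) => //=; rewrite ?andbF //= andbA.
Qed.

(** The orthogonal projection on the span of [s], provided that [s] is
orthonormal. *)
Definition proj s v := \sum_(u <- s) form v u *: u.

Lemma proj_span s v : proj s v \in << s >>%VS.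
Proof.
by rewrite /proj big_seq; apply: memv_suml => u us; rewrite memvZ ?memv_span.
Qed.

Lemma dot_projr s u v : form u (proj s v) = \sum_(w <- s) form u w * conj (form v w).
Proof.
rewrite linear_sumr; apply: eq_bigr => w _.
by rewrite linearZr_LR /= mulrC.
Qed.

(** Both sides are the Hermitian product of the coordinates of [u] and [v]
along [s], for an arbitrary family [s]. *)
Lemma proj_adjoint s u v : form (proj s u) v = form u (proj s v).
Proof.
rewrite dot_projr linear_sumlz; apply: eq_bigr => w _.
by rewrite linearZl_LR /= [form w v]dotC.
Qed.

Lemma dot_projl s u v : u \in s -> orthonormal form s ->
  form (proj s v) u = form v u.
Proof.
move=> us; rewrite -[s]/(tval (in_tuple s)) in us *; move=> os.
have [i ->] := tnthP _ _ us.
rewrite /proj linear_sumlz big_tuple (bigD1 i) //= linearZl_LR /=.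
rewrite (orthonormal_tnth i i os) eqxx mulr1 big1 ?addr0 // => j /negPf ji.
by rewrite linearZl_LR /= (orthonormal_tnth j i os) ji mulr0.
Qed.

Lemma dot_span0 s v w : {in s, forall u, form v u = 0} -> w \in << s >>%VS ->
  form v w = 0.
Proof.
move=> vs /(@coord_span _ _ _ (in_tuple s)) ->.
rewrite linear_sumr big1 // => i _; rewrite linearZr_LR /= vs ?mulr0 //.
by rewrite mem_nth.
Qed.

Lemma proj_residual_orth s v w : orthonormal form s -> w \in << s >>%VS ->
  form (v - proj s v) w = 0.
Proof.
move=> os; apply: dot_span0 => u us.
by rewrite linearBl /= dot_projl // subrr.
Qed.

Lemma proj_mem n (s : n.-tuple X) U v : basis_of U s -> proj s v \in U.
Proof. by move/span_basis <-; apply: proj_span. Qed.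

Lemma proj_residual_orthov n (s : n.-tuple X) U v :
  orthonormal form s -> basis_of U s -> v - proj s v \in orthov form U.
Proof.
move=> os bs; apply/mem_orthovP => w wU; apply: proj_residual_orth => //.
by rewrite (span_basis bs).
Qed.

Lemma dot_residual s u v : orthonormal form s ->
  form (u - proj s u) (v - proj s v) = form u v - form u (proj s v).
Proof.
move=> os; rewrite linearBr /= [X in _ - X](proj_residual_orth _ os) ?proj_span //.
by rewrite subr0 linearBl /= proj_adjoint.
Qed.

(** The residual belongs to the span and is orthogonal to it. *)
Lemma proj_id s v : orthonormal form s -> v \in << s >>%VS -> proj s v = v.
Proof.
move=> os vs; apply/eqP; rewrite eq_sym -subr_eq0; apply/eqP/dot0_eq0.
by apply: proj_residual_orth => //; rewrite memvB ?proj_span.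
Qed.

Lemma orthonormal_free s : orthonormal form s -> free s.
Proof.
rewrite -[s]/(tval (in_tuple s)) => os.
apply/freeP => k k0 i; rewrite -[RHS](linear0l form (tnth (in_tuple s) i)) -k0.
rewrite linear_sumlz (bigD1 i) //= linearZl_LR /= -(tnth_nth 0 (in_tuple s)).
rewrite (orthonormal_tnth i i os) eqxx mulr1 [X in _ + X]big1 ?addr0 //.
move=> j /negPf ji; rewrite linearZl_LR /= -(tnth_nth 0 (in_tuple s)).
by rewrite (orthonormal_tnth j i os) ji mulr0.
Qed.

(** Normalizing a vector takes a square root, which an arbitrary numeric field
need not contain. *)
Hypothesis normalizable : forall v, v != 0 -> exists a, form (a *: v) (a *: v) = 1.

(** Gram-Schmidt, by induction on the number of missing vectors.  The given
family stays in front, so that it keeps its indices in the resulting basis. *)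
Lemma orthonormal_extend U s : orthonormal form s -> {subset s <= U} ->
  exists t, orthonormal form (s ++ t) /\ basis_of U (s ++ t).
Proof.
move=> os sU; have := leq_addl (size s) (\dim U).
move: {2}(\dim U) => n; elim: n s os sU => [|n IH] s os sU.
  rewrite addn0 => dU; exists [::]; rewrite cats0; split=> //.
  rewrite basisEfree orthonormal_free // dU andbT /=.
  by apply/span_subvP.
move=> dU; have [Us|/subvPn[v vU vNs]] := boolP (U <= << s >>)%VS.
  exists [::]; rewrite cats0; split=> //.
  rewrite /basis_of orthonormal_free // andbT eqEsubv Us andbT.
  by apply/span_subvP.
have w0 : v - proj s v != 0.
  by rewrite subr_eq0; apply: contraNneq vNs => ->; apply: proj_span.
have [a w1] := normalizable w0.
have pU : proj s v \in U.
  by apply: subvP (proj_span s v); apply/span_subvP.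
have [|||t] := IH (rcons s (a *: (v - proj s v))).
- rewrite orthonormal_rcons os w1 eqxx /=; apply/allP => u us.
  rewrite dotC fmorph_eq0 linearZl_LR /= proj_residual_orth ?mulr0 //.
  exact: memv_span.
- move=> u; rewrite mem_rcons inE => /predU1P[->|/sU//].
  by rewrite memvZ // memvB.
- by rewrite size_rcons addSnnS.
rewrite cat_rcons; by exists (a *: (v - proj s v) :: t).
Qed.

Lemma orthonormal_basis U : exists g : (\dim U).-tuple X,
  orthonormal form g /\ basis_of U g.
Proof.
have [//|//|g [og bg]] := @orthonormal_extend U [::].
have sg : size g = \dim U by rewrite (size_basis (X := in_tuple g) bg).
by exists (tcast sg (in_tuple g)); rewrite val_tcast.
Qed.

End OrthonormalFamilies.

(** * The determinant attached to two subspaces *)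

Section GramDeterminant.
Variables (K : numFieldType) (conj : {rmorphism K -> K}).
Variables (X : vectType K) (form : {dot X for conj}).
Implicit Types (U V W : {vspace X}).

Definition dot_mx m n (e : m.-tuple X) (g : n.-tuple X) : 'M[K]_(m, n) :=
  \matrix_(i, j) form (tnth e i) (tnth g j).

Definition dot_gram m n (e : m.-tuple X) (g : n.-tuple X) : 'M[K]_m :=
  dot_mx e g *m map_mx conj (dot_mx e g)^T.

(** The entries are products of a vector with a projection; by self-adjointness
this makes [dot_gram e g] the Gram matrix of the projections of [e] on the
span of [g], when [g] is orthonormal. *)
Lemma dot_gramE m n (e : m.-tuple X) (g : n.-tuple X) i j :
  dot_gram e g i j = form (tnth e i) (proj form g (tnth e j)).
Proof.
rewrite dot_projr big_tuple mxE; apply: eq_bigr => k _.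
by rewrite !mxE.
Qed.

(** The matrix A that expresses [e'] in [e] satisfies A A^* = 1, and the two
matrices are related by G' = A G A^*. *)
Lemma dot_gram_invariant V m n (e e' : m.-tuple X) (g : n.-tuple X) :
  orthonormal form e -> basis_of V e -> orthonormal form e' -> basis_of V e' ->
  \det (dot_gram e' g) = \det (dot_gram e g).
Proof.
move=> oe be oe' be'; set A := dot_mx e' e.
have inV i : tnth e' i \in << e >>%VS.
  by rewrite (span_basis be) (basis_mem be') ?mem_tnth.
have A_unitary : A *m map_mx conj A^T = 1%:M.
  apply/matrixP => i j; rewrite [LHS]dot_gramE mxE proj_id ?orthonormal_tnth //.
have -> : dot_gram e' g = A *m dot_gram e g *m map_mx conj A^T.
  have -> : dot_gram e' g = dot_mx e' g *m map_mx conj (dot_mx e' g)^T by [].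
  have -> : dot_mx e' g = A *m dot_mx e g.
    apply/matrixP => i j; rewrite !mxE -{1}(proj_id oe (inV i)) /proj.
    rewrite linear_sumlz big_tuple; apply: eq_bigr => k _.
    by rewrite linearZl_LR /= !mxE.
  by rewrite trmx_mul map_mxM !mulmxA.
rewrite !det_mulmx mulrAC -det_mulmx A_unitary det1 mul1r //.
Qed.

(** The matrix factors through a space of dimension n. *)
Lemma det_dot_gram_eq0 m n (e : m.-tuple X) (g : n.-tuple X) :
  (n < m)%N -> \det (dot_gram e g) = 0.
Proof.
move=> nm; apply/eqP; apply: contraLR nm; rewrite -unitfE -unitmxE -leqNgt.
rewrite -row_free_unit => /eqP {1}<-.
by apply: leq_trans (mxrankM_maxl _ _) (rank_leq_col _).
Qed.

(** The projections on a subspace and on its orthogonal complement add up to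
the identity. *)
Lemma dot_gram_orthov W m n k (e : m.-tuple X) (f : n.-tuple X)
    (g : k.-tuple X) :
  orthonormal form e -> orthonormal form f -> basis_of W f ->
  orthonormal form g -> basis_of (orthov form W) g ->
  dot_gram e g = 1%:M - dot_gram e f.
Proof.
move=> oe of_ bf og bg; apply/matrixP => i j.
rewrite dot_gramE 2![in RHS]mxE [X in _ = _ + X]mxE dot_gramE.
rewrite -(orthonormal_tnth i j oe) -linearBr.
congr (form _ _); set v := tnth e j.
have resW : v - proj form f v \in orthov form W by apply: proj_residual_orthov.
rewrite -[RHS](proj_id og) ?(span_basis bg) //; apply: eq_big_seq => w wg.
have /mem_orthovP wW := basis_mem bg wg.
rewrite linearBl /= [X in _ - X]dotC wW ?rmorph0 ?subr0 //.
exact: proj_mem bf.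
Qed.

End GramDeterminant.

(** * Principal angles *)

Section PrincipalAngles.
Variables (R : realType) (K : numFieldType) (conj : {rmorphism K -> K}).
Variable toK : {rmorphism R -> K}.
Hypothesis conj_toK : forall x, conj (toK x) = toK x.
Hypothesis toK_nneg : forall z, 0 <= z -> exists2 x, 0 <= x & z = toK x.
Variables (X : vectType K) (form : {dot X for conj}).
Implicit Types (U V W : {vspace X}).

Lemma dot_normalize v : v != 0 -> exists a, form (a *: v) (a *: v) = 1.
Proof.
move=> v0; have fv : 0 < form v v := @neq0_dnorm_gt0 _ _ _ form v v0.
have [x x0 fx] := toK_nneg (ltW fv).
have tx : toK x != 0 by rewrite -fx gt_eqF.
have ts : toK (Num.sqrt x) * toK (Num.sqrt x) = toK x.
  by rewrite -rmorphM -expr2 sqr_sqrtr.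
exists (toK (Num.sqrt x))^-1.
rewrite linearZl_LR linearZr_LR /= fmorphV /= conj_toK mulrA -invfM ts fx.
by rewrite mulVf.
Qed.

(** Orthogonal vectors of norms [sigma i], with the null ones last, are the
multiples by the [sigma i] of the first vectors of an orthonormal basis of
[U]: normalize the nonzero ones and complete. *)
Lemma orthogonal_family_directions p (v : p.-tuple X) (sigma : nat -> R) U :
  {subset v <= U} ->
  (forall i j, form (tnth v i) (tnth v j)
               = if i == j then toK (sigma i) ^+ 2 else 0) ->
  (forall i j, (i <= j)%N -> (j < p)%N -> sigma i = 0 -> sigma j = 0) ->
  exists g : (\dim U).-tuple X,
    [/\ orthonormal form g, basis_of U g &
        forall (i : 'I_p) (j : 'I_(\dim U)),
          form (tnth v i) (tnth g j)
          = if i == j :> nat then toK (sigma i) else 0].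
Proof.
move=> vU vv_tnth sigma0.
have vv i j : (i < p)%N -> (j < p)%N ->
    form v`_i v`_j = if i == j then toK (sigma i) ^+ 2 else 0.
  move=> ip jp; have := vv_tnth (Ordinal ip) (Ordinal jp).
  by rewrite !(tnth_nth 0).
have exP : exists n, (p <= n)%N || (sigma n == 0) by exists p; rewrite leqnn.
(* r is the number of nonzero vectors. *)
case: (ex_minnP exP) => r Pr rmin {exP}.
have rp : (r <= p)%N by rewrite rmin ?leqnn.
have sigmaE i : (i < p)%N -> (sigma i == 0) = (r <= i)%N.
  move=> ip; apply/idP/idP => [si|ri]; first by rewrite rmin // si orbT.
  apply/eqP; apply: (sigma0 r) => //; apply/eqP; move: Pr.
  by rewrite leqNgt (leq_ltn_trans ri ip).
have toK0 i : (i < r)%N -> toK (sigma i) != 0.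
  by move=> ir; rewrite fmorph_eq0 sigmaE -?ltnNge // (leq_trans ir rp).
pose h := mkseq (fun i => (toK (sigma i))^-1 *: v`_i) r.
have hE i : (i < r)%N -> h`_i = (toK (sigma i))^-1 *: v`_i.
  by move=> ir; rewrite nth_mkseq.
have oh : orthonormal form h.
  apply/orthonormal_nthP; rewrite size_mkseq => i j ir jr.
  rewrite !hE // linearZl_LR linearZr_LR /= fmorphV /= conj_toK.
  rewrite vv ?(leq_trans _ rp) //.
  have [<-|_] := eqVneq i j; last by rewrite !mulr0.
  by rewrite mulrA -invfM mulVf // mulf_neq0 ?toK0.
have hU : {subset h <= U}.
  move=> w /(nthP 0)[k]; rewrite size_mkseq => kr <-.
  by rewrite hE // memvZ // vU // mem_nth // size_tuple (leq_trans kr rp).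
have [t [ot bt]] := orthonormal_extend dot_normalize oh hU.
have st : size (h ++ t) = \dim U by rewrite (size_basis (X := in_tuple _) bt).
exists (tcast st (in_tuple (h ++ t))); rewrite val_tcast; split=> // i j.
rewrite !(tnth_nth 0) val_tcast /=.
have [ri|ir] := leqP r i.
  have si0 : sigma i = 0 by apply/eqP; rewrite sigmaE.
  have -> : v`_i = 0.
    by apply: (@dot0_eq0 _ _ _ form); rewrite vv // eqxx si0 rmorph0 expr0n.
  by rewrite linear0l si0 rmorph0 if_same.
have -> : v`_i = toK (sigma i) *: (h ++ t)`_i.
  rewrite nth_cat size_mkseq ir hE // scalerA mulfV ?scale1r //.
  exact: toK0.
rewrite linearZl_LR /=; move/orthonormal_nthP: ot => ->; rewrite ?st //.
  by case: eqP; rewrite ?mulr1 ?mulr0.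
by rewrite -st size_cat size_mkseq (leq_trans ir) // leq_addr.
Qed.

(** A vector of a principal basis of V whose index exceeds the dimension q of W
is orthogonal to W, as if its angle were pi/2. *)
Definition padded_angle q (theta : seq R) i := if (i < q)%N then theta`_i else pi / 2.

Lemma prod_principal p q (theta : (minn p q).-tuple R) (F : R -> R) :
  \prod_(t <- theta) F t = \prod_(i < p) (if (i < q)%N then F theta`_i else 1).
Proof.
rewrite (big_nth 0) big_mkord size_tuple.
rewrite (big_ord_widen _ (fun i => F theta`_i) (geq_minl p q)) big_mkcond /=.
by apply: eq_bigr => i _; rewrite leq_min ltn_ord.
Qed.

Section PairOfBases.
Variables (p q : nat) (theta : (minn p q).-tuple R).
Hypothesis theta_itv : forall i, 0 <= tnth theta i <= pi / 2.

Let pihalf_itv : 0 <= (pi / 2 : R) <= pi / 2.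
Proof. by rewrite lexx andbT divr_ge0 ?pi_ge0. Qed.

Lemma padded_angle_itv i : (i < p)%N -> 0 <= padded_angle q theta i <= pi / 2.
Proof.
move=> ip; rewrite /padded_angle; case: ifPn => // iq.
have im : (i < minn p q)%N by rewrite leq_min ip.
by have := theta_itv (Ordinal im); rewrite (tnth_nth 0).
Qed.

Lemma padded_angle_le i j : sorted <=%R theta -> (i <= j)%N -> (j < p)%N ->
  padded_angle q theta i <= padded_angle q theta j.
Proof.
move=> th_sorted ij jp; have ip := leq_ltn_trans ij jp.
have := padded_angle_itv ip; rewrite /padded_angle.
have [iq|qi] := ltnP i q; have [jq|qj] := ltnP j q => //; last 2 first.
- by case/andP.
- by have := leq_ltn_trans ij jq; rewrite ltnNge qi.
move=> _; apply: (sorted_leq_nth le_trans lexx 0 th_sorted) => //;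
  by rewrite inE size_tuple leq_min ?ip ?jp.
Qed.

Lemma dot_gram_principal (e : p.-tuple X) (f : q.-tuple X) :
  (forall i j, inner form (tnth e i) (tnth f j)
     = if i == j :> nat then toK (cos theta`_i) else 0) ->
  dot_gram form e f
  = diag_mx (\row_i toK (cos (padded_angle q theta i) ^+ 2)).
Proof.
move=> ef; have efE i k : form (tnth e i) (tnth f k)
    = if i == k :> nat then toK (cos theta`_i) else 0.
  rewrite dotC; have := ef i k; rewrite /inner => ->.
  by case: ifP; rewrite ?conj_toK ?rmorph0.
apply/matrixP => i j; rewrite !mxE /padded_angle.
have [iq|qi] := ltnP i q; last first.
  rewrite cos_pihalf expr0n rmorph0 mul0rn big1 // => k _; rewrite !mxE efE.
  by rewrite gtn_eqF ?mul0r // (leq_trans (ltn_ord k)).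
rewrite (bigD1 (Ordinal iq)) //= big1 ?addr0 => [|k ki]; rewrite !mxE !efE.
  rewrite /= eqxx [in RHS]eq_sym -(inj_eq val_inj) /=; case: eqP => [->|_].
    by rewrite conj_toK -rmorphM expr2.
  by rewrite rmorph0 mulr0.
rewrite ifN ?mul0r // eq_sym; exact: ki.
Qed.

End PairOfBases.

(** The order is reversed because the angles with the complement of W are the
complements to pi/2 of the angles with W; the padding angles pi/2 give null
angles, which come first. *)
Lemma principal_angles_orthov V W (theta : (minn (\dim V) (\dim W)).-tuple R) :
  is_principal_angles toK form theta ->
  exists phi : (minn (\dim V) (\dim (orthov form W))).-tuple R,
    is_principal_angles toK form phi.
Proof.
case=> th_sorted th_itv [e [f [be oe bf of_ ef]]].
set p := \dim V; set q := \dim W; set d := \dim (orthov form W).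
pose a i := padded_angle q theta (p - i.+1).
have a_itv i : (i < p)%N -> 0 <= a i <= pi / 2.
  move=> ip; apply: padded_angle_itv => //.
  by rewrite ltn_subrL (leq_ltn_trans _ ip).
have a_anti i j : (i <= j)%N -> (j < p)%N -> a j <= a i.
  move=> ij jp; apply: padded_angle_le => //; first by rewrite leq_sub2l.
  by rewrite ltn_subrL (leq_ltn_trans _ jp).
pose e' : p.-tuple X := [tuple tnth e (rev_ord i) | i < p].
have e'E i : tnth e' i = tnth e (rev_ord i) by rewrite tnth_mktuple.
have e'V i : tnth e' i \in V by rewrite e'E (basis_mem be) ?mem_tnth.
have oe' : orthonormal form e'.
  apply: orthonormal_tnthI => i j; rewrite !e'E orthonormal_tnth //.
  by rewrite (inj_eq rev_ord_inj).
have be' : basis_of V e'.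
  rewrite basisEfree (orthonormal_free oe') size_tuple leqnn andbT.
  by apply/span_subvP => x /tnthP[k ->].
pose v := [tuple tnth e' i - proj form f (tnth e' i) | i < p].
have vE i : tnth v i = tnth e' i - proj form f (tnth e' i) by rewrite tnth_mktuple.
have vU : {subset v <= orthov form W}.
  move=> x /tnthP[k ->]; rewrite vE.
  exact: proj_residual_orthov.
have vv i j : form (tnth v i) (tnth v j)
    = if i == j then toK (sin (a i)) ^+ 2 else 0.
  rewrite !vE dot_residual // (orthonormal_tnth _ _ oe') !e'E -dot_gramE.
  rewrite (dot_gram_principal ef) !mxE (inj_eq rev_ord_inj).
  case: eqVneq => [->|_]; last by rewrite subr0.
  by rewrite mulr1n -(rmorph1 toK) -rmorphB /= -sin2cos2 rmorphXn.
(* The [tnth v i] are orthogonal of norms sin (a i); a sine vanishes on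
   [0, pi/2] only at 0, and [a] is nonincreasing, so null vectors come last. *)
have [|g [og bg vg]] :=
  orthogonal_family_directions (sigma := fun i => sin (a i)) vU vv.
  move=> i j ij jp si; have ip := leq_ltn_trans ij jp.
  have /andP[aj0 aj2] := a_itv j jp; have /andP[ai0 ai2] := a_itv i ip.
  have {ai0} ai_eq0 : a i = 0.
    apply/eqP; move: ai0; rewrite le_eqVlt eq_sym => /predU1P[/eqP//|ai0].
    suff: 0 < sin (a i) by rewrite si ltxx.
    rewrite sin_gt0_pi // ai0 (le_lt_trans ai2) // ltr_pdivrMr //.
    by rewrite mulr_natr mulr2n ltrDl pi_gt0.
  suff -> : a j = 0 by rewrite sin0.
  by apply: le_anti; rewrite aj0 -ai_eq0 a_anti.
have phiE i : (i < minn p d)%N ->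
    [tuple pi / 2 - a i | i < minn p d]`_i = pi / 2 - a i.
  by move=> im; rewrite -(tnth_nth 0 _ (Ordinal im)) tnth_mktuple.
exists [tuple pi / 2 - a i | i < minn p d]; split.
- apply/(sortedP 0) => i; rewrite size_tuple => im.
  rewrite !phiE ?(ltnW im) // lerD2l lerN2 a_anti //.
  by apply: leq_trans im (geq_minl _ _).
- move=> i; rewrite tnth_mktuple.
  have /andP[ai0 ai2] := a_itv i (leq_trans (ltn_ord i) (geq_minl _ _)).
  by rewrite subr_ge0 ai2 gerBl ai0.
exists e', g; split=> // i j.
(* The component of [tnth e' i] in W is orthogonal to [g]. *)
have -> : inner form (tnth e' i) (tnth g j) = conj (form (tnth v i) (tnth g j)).
  have /mem_orthovP gW := basis_mem bg (mem_tnth j g).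
  rewrite /inner dotC vE linearBl /= [form (proj _ _ _) _]dotC gW.
    by rewrite rmorph0 subr0.
  exact: proj_mem bf.
rewrite vg; case: eqP => [ij|_]; last by rewrite rmorph0.
rewrite conj_toK phiE ?leq_min ?ltn_ord ?ij ?ltn_ord //.
by rewrite -cosN opprB cosBpihalf.
Qed.

(** Under the dimension hypothesis each of the basis vectors of V has its own
principal angle. *)
Lemma det_dot_gram_principal V W (theta : (minn (\dim V) (\dim W)).-tuple R)
    (e : (\dim V).-tuple X) (f : (\dim W).-tuple X) :
  (\dim V <= \dim W)%N ->
  (forall i j, inner form (tnth e i) (tnth f j)
     = if i == j :> nat then toK (cos theta`_i) else 0) ->
  \det (dot_gram form e f) = toK ((\prod_(t <- theta) cos t) ^+ 2).
Proof.
move=> pq /dot_gram_principal ->.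
rewrite det_diag -prodrXl prod_principal rmorph_prod; apply: eq_bigr => i _.
by rewrite mxE /padded_angle (leq_trans (ltn_ord i) pq).
Qed.

(** The padding angles contribute factors sin^2 (pi/2) = 1. *)
Lemma det_dot_gram_orthov V W (theta : (minn (\dim V) (\dim W)).-tuple R)
    (e : (\dim V).-tuple X) (f : (\dim W).-tuple X) n (g : n.-tuple X) :
  orthonormal form e -> orthonormal form f -> basis_of W f ->
  orthonormal form g -> basis_of (orthov form W) g ->
  (forall i j, inner form (tnth e i) (tnth f j)
     = if i == j :> nat then toK (cos theta`_i) else 0) ->
  \det (dot_gram form e g) = toK ((\prod_(t <- theta) sin t) ^+ 2).
Proof.
move=> oe of_ bf og bg ef.
rewrite (dot_gram_orthov oe of_ bf og bg) (dot_gram_principal ef).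
rewrite -diag_const_mx -linearB det_diag.
rewrite -prodrXl prod_principal rmorph_prod; apply: eq_bigr => i _.
rewrite !mxE -(rmorph1 toK) -rmorphB -sin2cos2 /padded_angle.
by case: ifP; rewrite ?sin_pihalf ?expr1n.
Qed.

Theorem cos_complementary_grassmann_angle V W
    (theta : (minn (\dim V) (\dim W)).-tuple R) :
  V != 0%VS -> is_principal_angles toK form theta ->
  cos (complementary_grassmann_angle toK form V W) = \prod_(t <- theta) sin t.
Proof.
move=> V0 th; have [_ th_itv [e [f [be oe bf of_ ef]]]] := th.
have halfpi : (pi / 2 : R) <= pi.
  by rewrite ler_pdivrMr // mulr_natr mulr2n lerDl pi_ge0.
have pos n (psi : n.-tuple R) (F : R -> R) :
    (forall x, 0 <= x <= pi / 2 -> 0 <= F x <= 1) ->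
    (forall i, 0 <= tnth psi i <= pi / 2) -> 0 <= \prod_(t <- psi) F t <= 1.
  move=> HF Hpsi; rewrite big_tuple.
  apply/andP; split; last by apply: Num.Theory.prodr_ile1 => i _; apply: HF.
  by apply: prodr_ge0 => i _; have /andP[] := HF _ (Hpsi i).
have cos_itv (x : R) : 0 <= x <= pi / 2 -> 0 <= cos x <= 1.
  move=> /andP[x0 x2]; rewrite cos_le1 cos_ge0_pihalf // x2 andbT.
  by rewrite (le_trans _ x0) // oppr_le0 (le_trans x0).
have sin_itv (x : R) : 0 <= x <= pi / 2 -> 0 <= sin x <= 1.
  by move=> /andP[x0 x2]; rewrite sin_le1 sin_ge0_pi // x0 (le_trans x2).
have dV_gt0 : (0 < \dim V)%N by rewrite lt0n dimv_eq0.
rewrite /complementary_grassmann_angle /grassmann_angle (negPf V0).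
set U := orthov form W; have [pd|] := boolP (\dim V <= \dim U)%N; last first.
  rewrite -ltnNge => dp.
  (* The angle is pi/2 by definition, whether or not U is null. *)
  rewrite if_same cos_pihalf.
  have [g [og bg]] := orthonormal_basis dot_normalize U.
  have := det_dot_gram_orthov oe of_ bf og bg ef.
  rewrite det_dot_gram_eq0 // => /esym/eqP.
  by rewrite fmorph_eq0 expf_eq0 /= => /eqP.
rewrite -dimv_eq0 -leqn0 leqNgt (leq_trans dV_gt0 pd) /=.
have : is_principal_angles toK form (principal_angles toK form V U).
  exact: xgetPex (principal_angles_orthov th).
set phi := principal_angles _ _ _ _.
case=> _ phi_itv [e' [g [be' oe' bg og eg]]].
have /andP[c0 c1] := pos _ _ _ cos_itv phi_itv.
rewrite acosK; last by rewrite in_itv /= c1 andbT (le_trans _ c0) ?lerN10.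
have /andP[s0 _] := pos _ _ _ sin_itv th_itv.
(* Both products are nonnegative, so that their squares can be compared. *)
apply/eqP; rewrite -(@eqrXn2 _ 2) //; apply/eqP/(fmorph_inj toK).
rewrite -(det_dot_gram_orthov oe of_ bf og bg ef).
rewrite -(det_dot_gram_principal pd eg).
exact: dot_gram_invariant oe be oe' be'.
Qed.

End PrincipalAngles.

(** * The real and the complex case *)

Theorem theorem5p3 (R : realType) :
  (forall (X : vectType R) (form : {dot X for idfun}) (V W : {vspace X})
      (theta : (minn (\dim V) (\dim W)).-tuple R),
    V != 0%VS -> W != 0%VS ->
    is_principal_angles (idfun : R -> R) form theta ->
    cos (complementary_grassmann_angle (idfun : R -> R) form V W)
    = \prod_(t <- theta) sin t)
  /\
  (forall (X : vectType R[i]) (form : {dot X for Num.conj}) (V W : {vspace X})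
      (theta : (minn (\dim V) (\dim W)).-tuple R),
    V != 0%VS -> W != 0%VS ->
    is_principal_angles (real_complex R) form theta ->
    cos (complementary_grassmann_angle (real_complex R) form V W)
    = \prod_(t <- theta) sin t).
Proof.
split=> X form V W theta V0 _.
  apply: (@cos_complementary_grassmann_angle R R idfun idfun) => // z z0.
  by exists z.
apply: (@cos_complementary_grassmann_angle R R[i] Num.conj (real_complex R)) => //.
  by move=> x; rewrite -[LHS]/((x%:C)^*)%C conjc_real.
case=> x y; rewrite lecE /= => /andP[/eqP y0 x0]; exists x => //.
by rewrite y0.
Qed.
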